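(* Under strong mutation equivalence, every triangulation of the $\infty$-gon $C_\infty$ belongs to exactly one of the following sets, and each of these sets is a strong mutation equivalence class: (i) the class $[T_{lf}]$ of all locally finite triangulations of $C_\infty$; (ii) for a unique pair $a,b\in\mathbb{Z}$ with $a\leq b$, the class $[T(a,b)]$ of all triangulations of $C_\infty$ with a left fountain at $a$ and a right fountain at $b$. In other words, two triangulations of $C_\infty$ are strongly mutation equivalent if and only if they are both locally finite or they both have a left fountain at $a$ and a right fountain at $b$ for some $a,b\in\mathbb{Z}$ with $a\leq b$.
   Context: The $\infty$-gon $C_\infty$ is the disc with a discrete set of boundary marked points with one two-sided limit point (not marked); marked points are identified with $\mathbb{Z}$. Combinatorially: an arc of $C_\infty$ is a pair of integers $(i,j)$ with $i\leq j-2$. Arcs $(i,j)$ and $(k,l)$ are not compatible (intersect) if and only if $i<k<j<l$ or $k<i<l<j$. A triangulation is a maximal set of pairwise compatible arcs. A triangulation $T$ is locally finite if for each $l\in\mathbb{Z}$ there are only finitely many arcs of the form $(k,l)$ or $(l,m)$ in $T$. $T$ has a left fountain at $n\in\mathbb{Z}$ if $(p,n)\in T$ for infinitely many $p\leq n-2$, and a right fountain at $n$ if $(n,p)\in T$ for infinitely many $p\geq n+2$. Mutation: $\theta\in T$ is mutable if there is an arc $\theta'\neq\theta$ (then unique) such that $\mu_\theta(T)=(T\setminus\{\theta\})\cup\{\theta'\}$ is a triangulation. For $\gamma\in T$ put $\mu_\theta(\gamma)=\gamma$ if $\gamma\neq\theta$ and $\mu_\theta(\theta)=\theta'$. Admissible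 sequences: let $I=\{1,\dots,n\}$ or $I=\mathbb{Z}_{>0}$. A sequence of arcs $\underline{\theta}=(\theta_i)_{i\in I}$ is $T$-admissible if (1) $\theta_1$ is mutable in $T$; (2) for all $1\neq i\in I$, $\theta_i$ is mutable in $\mu_{\theta_{i-1}}\circ\cdots\circ\mu_{\theta_1}(T)$; (3) for every $\gamma\in T$ there is $l_\gamma\in I$ such that $\mu_{\theta_k}\circ\cdots\circ\mu_{\theta_1}(\gamma)=\mu_{\theta_{l_\gamma}}\circ\cdots\circ\mu_{\theta_1}(\gamma)$ for all $k\in I$, $k\geq l_\gamma$. Then $\mu_{\underline{\theta}}(\gamma)=\mu_{\theta_{l_\gamma}}\circ\cdots\circ\mu_{\theta_1}(\gamma)$ and $\mu_{\underline{\theta}}(T)=\{\mu_{\underline{\theta}}(\gamma)\mid\gamma\in T\}$. Write $T\leq_s T'$ if there is a $T$-admissible sequence $\underline{\theta}$ with $\mu_{\underline{\theta}}(T)=T'$. Triangulations $T,T'$ are strongly mutation equivalent if $T\leq_s T'$ and $T'\leq_s T$. *)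

(* Defs.v *)
From mathcomp Require Import all_boot all_order all_algebra.
From mathcomp Require Import all_classical.

Set Implicit Arguments.
Unset Strict Implicit.
Unset Printing Implicit Defensive.

Import Order.TTheory GRing.Theory Num.Theory.
Local Open Scope classical_set_scope.
Local Open Scope ring_scope.

(* An arc of the infinity-gon is a pair of integers (i, j) with i <= j - 2;
   sets of arcs are sets of pairs included in [arcs]. *)
Definition arcs : set (int * int) := [set x | x.1 <= x.2 - 2].

Definition crossing (x y : int * int) : Prop :=
  (x.1 < y.1 < x.2 /\ x.2 < y.2) \/ (y.1 < x.1 < y.2 /\ y.2 < x.2).

Definition pairwise_compatible (S : set (int * int)) : Prop :=
  S `<=` arcs /\ forall x y, S x -> S y -> ~ crossing x y.

Definition triangulation (T : set (int * int)) : Prop :=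
  pairwise_compatible T /\
  forall S, pairwise_compatible S -> T `<=` S -> S = T.

Definition locally_finite (T : set (int * int)) : Prop :=
  forall l : int, finite_set [set x | T x /\ (x.1 = l \/ x.2 = l)].

Definition left_fountain (T : set (int * int)) (n : int) : Prop :=
  infinite_set [set p : int | p <= n - 2 /\ T (p, n)].

Definition right_fountain (T : set (int * int)) (n : int) : Prop :=
  infinite_set [set p : int | n + 2 <= p /\ T (n, p)].

Definition exchange (T : set (int * int)) (t t' : int * int) : Prop :=
  [/\ T t, arcs t', t' <> t & triangulation ((T `\ t) `|` [set t'])].

Definition mutable (T : set (int * int)) (t : int * int) : Prop :=
  exists t', exchange T t t'.

(* The arc replacing t; the junk value t when t is not mutable in T. *)
Definition flip (T : set (int * int)) (t : int * int) : int * int :=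
  xget t [set t' | exchange T t t'].

Definition mutate (T : set (int * int)) (t : int * int) : set (int * int) :=
  (T `\ t) `|` [set flip T t].

Definition mutate_arc (T : set (int * int)) (t x : int * int) : int * int :=
  if x == t then flip T t else x.

(* Sequences of arcs are functions on nat indexed from 1 as in (theta_i)_{i in I};
   their values outside I (in particular at 0) are never used.
   [mutate_iter T theta k] is mu_{theta_k} o ... o mu_{theta_1} (T). *)
Fixpoint mutate_iter (T : set (int * int)) (theta : nat -> int * int) (k : nat)
    : set (int * int) :=
  if k is k'.+1 then mutate (mutate_iter T theta k') (theta k) else T.

Fixpoint mutate_arc_iter (T : set (int * int)) (theta : nat -> int * int)
    (k : nat) (x : int * int) : int * int :=
  if k is k'.+1
  then mutate_arc (mutate_iter T theta k') (theta k)
         (mutate_arc_iter T theta k' x)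
  else x.

Definition index_set (I : set nat) : Prop :=
  (exists2 n : nat, (1 <= n)%N & I = [set i | (1 <= i <= n)%N]) \/
  I = [set i | (1 <= i)%N].

Definition stable_from (I : set nat) (T : set (int * int))
    (theta : nat -> int * int) (x : int * int) (l : nat) : Prop :=
  I l /\ forall k, I k -> (l <= k)%N ->
    mutate_arc_iter T theta k x = mutate_arc_iter T theta l x.

Definition admissible (I : set nat) (T : set (int * int))
    (theta : nat -> int * int) : Prop :=
  (forall i, I i -> mutable (mutate_iter T theta i.-1) (theta i)) /\
  (forall x, T x -> exists l, stable_from I T theta x l).

(* mu_theta(x); the value does not depend on the chosen index l. *)
Definition mutate_arc_seq (I : set nat) (T : set (int * int))
    (theta : nat -> int * int) (x : int * int) : int * int :=
  mutate_arc_iter T theta (xget 0%N [set l | stable_from I T theta x l]) x.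

Definition mutate_seq (I : set nat) (T : set (int * int))
    (theta : nat -> int * int) : set (int * int) :=
  mutate_arc_seq I T theta @` T.

Definition mutation_le (T T' : set (int * int)) : Prop :=
  exists (I : set nat) (theta : nat -> int * int),
    [/\ index_set I, admissible I T theta & mutate_seq I T theta = T'].

Definition strongly_mutation_equivalent (T T' : set (int * int)) : Prop :=
  mutation_le T T' /\ mutation_le T' T.

Definition strong_mutation_class (C : set (set (int * int))) : Prop :=
  exists2 T, triangulation T &
    C = [set T' | triangulation T' /\ strongly_mutation_equivalent T T'].

Definition T_lf : set (set (int * int)) :=
  [set T | triangulation T /\ locally_finite T].

Definition T_fountains (a b : int) : set (set (int * int)) :=
  [set T | [/\ triangulation T, left_fountain T a & right_fountain T b]].

(* Main.v *)
Require Import Defs.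
From mathcomp Require Import all_boot all_order all_algebra zify.
From mathcomp Require Import all_classical.

Set Implicit Arguments.
Unset Strict Implicit.
Unset Printing Implicit Defensive.

Import Order.TTheory GRing.Theory Num.Theory.
Local Open Scope classical_set_scope.
Local Open Scope ring_scope.

(** The theorem follows from a description of the preorder [mutation_le] in terms
    of crossings ([mutation_leP]): for triangulations [T] and [T'], an admissible
    sequence leads from [T] to [T'] if and only if every arc of [T'] crosses only
    finitely many arcs of [T].

    Necessity: an arc [d] of the limit is present at some finite stage. It crosses
    no arc of that stage, and only finitely many arcs of [T] have been flipped
    before it.

    Sufficiency: let [d] cross at least one but only finitely many arcs of a
    triangulation [S]. The first arc that [d] meets on its way from its left end
    is a diagonal of a quadrilateral of [S] with a corner at that end, and flipping
    it gives an arc with the same end, which therefore does not cross [d]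
    ([flip_near_left]). The same holds at the right end by reflection. Given [x] in
    [S] crossing [d], flipping from both ends towards [x] until only [x] crosses
    [d], and then [x] itself, moves [x] onto [d], and all arcs flipped on the way
    cross [d] ([steer]). When [d] lies in [T'], no arc of [T'] is flipped, so
    whatever has reached [T'] stays there. Each arc of [T] outside [T'] crosses
    some arc of [T'] and can be steered onto it; each arc of [T'] not yet produced
    crosses some current arc, which can be steered onto it. Doing this for all arcs
    in turn gives an admissible sequence with limit [T']: the care about where each
    single arc goes, rather than only about the set of arcs, is what makes every
    arc come to rest.

    The classes are then read off from crossings. If no arc of [T] spans a marked
    point [b], then [T] has a left fountain at [b] or at the leftmost neighbour of
    [b] ([left_fountain_exists]), and symmetrically on the right. If infinitely many
    arcs of [T] meet at a marked point, it is the centre of a fountain and no arc of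
    [T] spans it; hence a triangulation is either locally finite or has exactly one left and one right
    fountain. If [T] has a left fountain at [a] and [mutation_le T T'], no arc of
    [T'] spans [a], so [T'] has a left fountain at some [a' <= a]; similarly right
    fountains can only move to the right. (They can indeed move: the fan at [a]
    with all arcs ending or starting at [a] can be carried to a left fountain at
    [a - 1] and a right fountain at [a].) Going in both directions fixes them.
    Conversely, if [T] and [T'] are both locally finite, or have the same fountains,
    an arc of [T'] spans no marked point at which [T] has infinitely many arcs, so
    it crosses finitely many arcs of [T]. *)

(** * Integers and finiteness *)

Lemma int_max (P : int -> Prop) (M : int) :
  (exists x, P x) -> (forall x, P x -> x <= M) ->
  exists2 m, P m & forall x, P x -> x <= m.
Proof.
move=> [x Px] PM; have [n Mn] : exists n, (`|M - x| <= n)%N by exists `|M - x|%N.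
elim: n x Px Mn => [|n IHn] x Px Mn.
  by exists x => // y Py; have := PM _ Py; have := PM _ Px; lia.
have [[y [Py xy]]|noy] := pselect (exists y, P y /\ x < y).
  by apply: (IHn y) => //; have := PM _ Py; lia.
exists x => // y Py; have [//|xy] := lerP y x.
by case: noy; exists y.
Qed.

Lemma int_min (P : int -> Prop) (M : int) :
  (exists x, P x) -> (forall x, P x -> M <= x) ->
  exists2 m, P m & forall x, P x -> m <= x.
Proof.
move=> [x Px] PM.
have [||m Pm mP] := @int_max (fun y => P (- y)) (- M).
- by exists (- x); rewrite opprK.
- by move=> y /PM; lia.
by exists (- m) => // y Py; have := mP (- y); rewrite opprK => /(_ Py); lia.
Qed.

Lemma finite_set_ubound (X : Type) (f : X -> int) (A : set X) :
  finite_set A -> exists M, forall x, A x -> f x <= M.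
Proof.
move=> /(finite_image f)/finite_seqP[s /seteqP[fs _]].
suff [M sM] : exists M, forall y, y \in s -> y <= M.
  by exists M => x Ax; apply/sM/fs; exists x.
elim: s {fs} => [|y s [M sM]]; first by exists 0.
exists (Num.max y M) => z; rewrite inE => /orP[/eqP->|/sM]; lia.
Qed.

Lemma finite_set_itv (m n : int) : finite_set [set p : int | m <= p <= n].
Proof.
apply: (@sub_finite_set _ _ [set` [seq m + k%:Z | k <- iota 0 `|n - m|.+1]]).
  rewrite /mkset => p mpn; apply/mapP; exists `|p - m|%N; last by lia.
  by rewrite mem_iota; lia.
by apply/finite_seqP; eexists.
Qed.

(** * Arcs and triangulations *)

Ltac arclia := unfold crossing, arcs, mkset in *; simpl in *; lia.

Lemma crossingC x y : crossing x y -> crossing y x.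
Proof. arclia. Qed.

(** Boundary segments count as edges so that the sides of triangles and of
    quadrilaterals can be treated uniformly. *)
Definition edge (S : set (int * int)) (i j : int) : Prop :=
  S (i, j) \/ j = i + 1.

Section Triangulation.
Variable S : set (int * int).
Hypothesis trS : triangulation S.

Lemma tri_arcs x : S x -> x.1 <= x.2 - 2.
Proof. by case: trS => -[SA _] _ /SA. Qed.

Lemma tri_compat x y : S x -> S y -> ~ crossing x y.
Proof. by case: trS => -[_ SC] _ Sx Sy; apply: SC. Qed.

Lemma tri_max z : arcs z -> (forall y, S y -> ~ crossing z y) -> S z.
Proof.
move=> Az zS; case: trS => SC maxS.
have SzC : pairwise_compatible (S `|` [set z]).
  split=> [x [/tri_arcs//|->//]|x y [Sx|->] [Sy|->]].
  - exact: tri_compat.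
  - by move/crossingC; apply: zS.
  - exact: zS.
  - arclia.
by rewrite -(maxS _ SzC); [right|move=> x; left].
Qed.

Lemma edge_lt i j : edge S i j -> i < j.
Proof. by case=> [/tri_arcs/=|]; lia. Qed.

Lemma edge_compat i j y : edge S i j -> S y -> ~ crossing (i, j) y.
Proof. by case=> [Sij Sy|-> _]; [exact: tri_compat|arclia]. Qed.

Lemma edge_max i j :
  i < j -> (forall k l, S (k, l) -> ~ crossing (i, j) (k, l)) -> edge S i j.
Proof.
move=> ij ijS; have [->|nij] := eqVneq j (i + 1); first by right.
by left; apply: tri_max => [|[k l]]; [arclia|exact: ijS].
Qed.

(** The third corner is the last neighbour of [i] before [j]. *)
Lemma inner_triangle i j : S (i, j) ->
  exists m, [/\ i < m < j, edge S i m & edge S m j].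
Proof.
move=> Sij; have /= ij := tri_arcs Sij.
have [||m [imj eim] mmax] := @int_max (fun m => i < m < j /\ edge S i m) j.
- by exists (i + 1); split; [lia|right].
- by move=> m []; lia.
exists m; split=> //; apply: edge_max => [|k l Skl]; first by lia.
have := tri_compat Sij Skl; have := edge_compat eim Skl.
have := tri_arcs Skl => /=.
have : k = i -> l < j -> l <= m.
  move=> ki lj; apply: mmax; rewrite -ki; split; last by left.
  by have := tri_arcs Skl => /=; lia.
arclia.
Qed.

(** Otherwise [t] would already be in [S] by maximality, and the exchange would only
    remove [c] and so fail to be maximal. *)
Lemma exchange_crossing c t : exchange S c t -> crossing t c.
Proof.
move=> [Sc At tc [trt maxt]]; apply: contrapT => ntc.
have St : S t.
  apply: tri_max => // y Sy; have [->//|/eqP yc] := eqVneq y c.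
  by case: trt => _; apply; [right|left; split].
have ES : S = (S `\ c) `|` [set t].
  by apply: maxt; [case: trS|move=> y [[]|->]].
by move: Sc; rewrite ES => -[[_ /(_ erefl)]|/esym].
Qed.

(** The only arc that crosses a diagonal of a quadrilateral without crossing a side
    is the other diagonal. Applied to the arcs of [S], to those of a larger
    compatible set and to the candidates for a replacement, this gives
    compatibility, maximality and uniqueness. *)
Lemma quad_exchange a b c d e e' :
  a < b < c -> c < d ->
  edge S a b -> edge S b c -> edge S c d -> edge S a d -> S e ->
  (e = (a, c) /\ e' = (b, d)) \/ (e = (b, d) /\ e' = (a, c)) ->
  exchange S e e' /\ forall t, exchange S e t -> t = e'.
Proof.
move=> abc cd ab bc' cd' ad Se ee'.
have sides R y : pairwise_compatible R -> S `\ e `<=` R -> R y ->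
    [/\ ~ crossing (a, b) y, ~ crossing (b, c) y, ~ crossing (c, d) y &
        ~ crossing (a, d) y].
  move=> [_ RC] SR Ry.
  have side i j : edge S i j -> (i, j) <> e -> ~ crossing (i, j) y.
    by case=> [Sij ije|-> _]; [apply: RC => //; apply: SR|arclia].
  by split; apply: side => //; case: ee' => -[-> _] [] *; lia.
have ee'X : crossing e e' by case: ee' => -[-> ->]; arclia.
have Ae' : arcs e' by case: ee' => -[_ ->]; arclia.
have other y : arcs y -> ~ crossing (a, b) y -> ~ crossing (b, c) y ->
    ~ crossing (c, d) y -> ~ crossing (a, d) y ->
    (crossing e y -> y = e') /\ (crossing e' y -> y = e).
  by case: y => k l; case: ee' => -[-> ->] *; split=> *; congr (_, _); arclia.
split; last first.
  move=> t Et; have tX := exchange_crossing Et; case: Et => _ At _ [tC _].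
  have [||n1 n2 n3 n4] := sides _ t tC; [by left|by right|].
  by have [+ _] := other _ At n1 n2 n3 n4; apply; apply: crossingC.
have e'S y : S y -> y <> e -> ~ crossing e' y.
  move=> Sy ye; have [||//|n1 n2 n3 n4] := sides S y; [by case: trS|by move=> x []|].
  by have [_ +] := other _ (tri_arcs Sy) n1 n2 n3 n4 => /[apply].
split=> //; first by move=> E; move: ee'X; rewrite E; arclia.
split.
  split=> [x [[/tri_arcs//]|->//]|x y [[Sx xe]|->] [[Sy ye]|->]].
  - exact: tri_compat.
  - by move/crossingC; apply: e'S.
  - exact: e'S.
  - arclia.
move=> R RC SR; apply/seteqP; split=> // z Rz.
have Az : arcs z by case: RC => + _; apply.
have [->|/eqP ze'] := eqVneq z e'; first by right.
have Re' : R e' by apply: SR; right.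
left; split; last first.
  by move=> zE; case: RC => _ /(_ _ _ Re' Rz); rewrite zE => /(_ (crossingC ee'X)).
apply: tri_max => // y Sy; have [->|/eqP ye] := eqVneq y e.
  have [||//|n1 n2 n3 n4] := sides R z => //; first by move=> x Sx; apply: SR; left.
  by have [+ _] := other _ Az n1 n2 n3 n4 => + /crossingC => /[apply].
by case: RC => _ /(_ _ y Rz); apply; apply: SR; left.
Qed.

End Triangulation.

(** * Flips that uncross an arc *)

Definition sole_exchange S c c' : Prop :=
  exchange S c c' /\ forall t, exchange S c t -> t = c'.

Definition crossed_by (S : set (int * int)) (d : int * int) : set (int * int) :=
  [set y | S y /\ crossing y d].

(** [away v c y]: the arc [y] lies on the side of [c] that does not contain the
    marked point [v]. *)
Definition away (v : int) (c y : int * int) : Prop :=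
  if c.1 < v < c.2
  then (y.1 <= c.1 \/ c.2 <= y.1) /\ (y.2 <= c.1 \/ c.2 <= y.2)
  else c.1 <= y.1 /\ y.2 <= c.2.

(** Walking along [d] from its left end [i], the first arc met is found by taking
    the endpoint [p] under [d] closest to [i], then the other endpoint [q] closest
    to [i], where points left of [i] come before points right of [d]. The segments
    [ip] and [iq] are edges. The triangle beyond [pq] has a third corner [w], so
    flipping [pq] gives [iw]. Its existence uses finiteness: an arc [(a, b)]
    joining two fountains has no triangle above it. *)
Lemma flip_near_left S d :
  triangulation S -> arcs d -> finite_set (crossed_by S d) ->
  crossed_by S d !=set0 ->
  exists c c', [/\ crossed_by S d c, ~ crossing c' d, sole_exchange S c c' &
    forall y, crossed_by S d y -> away d.1 c y].
Proof.
case: d => i j trS Ad fin [[x1 x2] [Sx xd]] /=.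
have [M crM] := finite_set_ubound snd fin.
have bnd k l : S (k, l) -> i < k < j -> j < l -> l <= M.
  by move=> Skl ? ?; apply: (crM (k, l)); split=> //; arclia.
pose inner p q := (q < i /\ S (q, p)) \/ (j < q /\ S (p, q)).
have [||p [ipj [q0 pq0]] pmin] :=
    @int_min (fun p => i < p < j /\ exists q, inner p q) i.
- have [[ix xj]|xo] := pselect (i < x1 /\ x1 < j).
    by exists x1; split; [lia|exists x2; right; split=> //; arclia].
  by exists x2; split; [arclia|exists x1; left; split=> //; arclia].
- by move=> p [] *; lia.
have far k l : S (k, l) ->
    (k < i -> i < l < j -> p <= l) /\ (i < k < j -> j < l -> p <= k).
  move=> Skl; split=> h1 h2; apply: pmin.
    by split=> //; exists k; left.
  by split=> //; exists l; right.
have chord k l : S (k, l) -> k <= l - 2 by move/(tri_arcs trS).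
have [[q1 [q1i Sq1]]|noleft] := pselect (exists q, q < i /\ S (q, p)).
  have [||q [qi Sqp] qmax] := @int_max (fun q => q < i /\ S (q, p)) i.
  - by exists q1.
  - by move=> q []; lia.
  have qmax' k l : S (k, l) -> l = p -> k < i -> k <= q.
    by move=> + lp; rewrite lp => Skp ki; apply: qmax.
  have Eip : edge S i p.
    apply: (edge_max trS) => [|k l Skl]; first by lia.
    have := far _ _ Skl; have := tri_compat trS Sqp Skl; arclia.
  have Eqi : edge S q i.
    apply: (edge_max trS) => [|k l Skl]; first by lia.
    have := far _ _ Skl; have := tri_compat trS Sqp Skl.
    have := qmax' _ _ Skl; have := chord _ _ Skl; arclia.
  have pfar y : crossed_by S (i, j) y -> away i (q, p) y.
    case: y => k l [Skl kld]; rewrite /away /= ifT; last by lia.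
    have := far _ _ Skl; have := tri_compat trS Sqp Skl.
    have := qmax' _ _ Skl; arclia.
  (* [w] is the neighbour of [p] closest to [q], going right from [p] to
     infinity and then from minus infinity up to [q]. *)
  have [[w1 [w1q Sw1]]|noleft] := pselect (exists w, w < q /\ S (w, p)).
    have [||w [wq Swp] wmax] := @int_max (fun w => w < q /\ S (w, p)) q.
    - by exists w1.
    - by move=> w []; lia.
    have wmax' k l : S (k, l) -> l = p -> k < q -> k <= w.
      by move=> + lp; rewrite lp => Skp ki; apply: wmax.
    have Ewq : edge S w q.
      apply: (edge_max trS) => [|k l Skl]; first by lia.
      have := tri_compat trS Sqp Skl; have := tri_compat trS Swp Skl.
      have := wmax' _ _ Skl; have := chord _ _ Skl; arclia.
    exists (q, p), (w, i); split; [split=> //; arclia|arclia| |exact: pfar].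
    apply: (@quad_exchange _ trS w q i p); rewrite ?wq //; try lia.
    - by left.
    - by right.
  have [||w [pw Epw] wmax] := @int_max (fun w => p < w /\ edge S p w) (Num.max j M).
  - by exists (p + 1); split; [lia|right].
  - move=> w [pw [Spw|->]]; last by lia.
    by have := bnd _ _ Spw; lia.
  have wmax' k l : S (k, l) -> k = p -> l <= w.
    move=> + kp; rewrite kp => Spl; apply: wmax; split; last by left.
    by have := chord _ _ Spl; lia.
  have noleft' k l : S (k, l) -> l = p -> q <= k.
    move=> + lp; rewrite lp => Skp; have [//|kq] := lerP q k.
    by case: noleft; exists k.
  have Eqw : edge S q w.
    apply: (edge_max trS) => [|k l Skl]; first by lia.
    have := tri_compat trS Sqp Skl; have := edge_compat trS Epw Skl.
    have := wmax' _ _ Skl; have := noleft' _ _ Skl; have := chord _ _ Skl; arclia.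
  exists (q, p), (i, w); split; [split=> //; arclia|arclia| |exact: pfar].
  apply: (@quad_exchange _ trS q i p w) => //; try lia.
  by left.
have noleft' k l : S (k, l) -> l = p -> i <= k.
  move=> + lp; rewrite lp => Skp; have [//|ki] := lerP i k.
  by case: noleft; exists k.
have [||q [jq Spq] qmax] := @int_max (fun q => j < q /\ S (p, q)) M.
- exists q0; case: pq0 => [[q0i Sq0]|//].
  by case: noleft; exists q0.
- by move=> q [jq Spq]; apply: bnd Spq _ _; lia.
have qmax' k l : S (k, l) -> k = p -> j < l -> l <= q.
  by move=> + kp; rewrite kp => Spl jl; apply: qmax.
have Eip : edge S i p.
  apply: (edge_max trS) => [|k l Skl]; first by lia.
  have := far _ _ Skl; have := tri_compat trS Spq Skl; arclia.
have Eiq : edge S i q.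
  apply: (edge_max trS) => [|k l Skl]; first by lia.
  have := far _ _ Skl; have := tri_compat trS Spq Skl.
  have := qmax' _ _ Skl; have := noleft' _ _ Skl; have := chord _ _ Skl; arclia.
have [w [pwq Epw Ewq]] := inner_triangle trS Spq.
exists (p, q), (i, w); split; [split=> //; arclia|arclia| |].
  apply: (@quad_exchange _ trS i p w q) => //; try lia.
  by right.
case=> k l [Skl kld]; rewrite /away /= ifF; last by lia.
have := far _ _ Skl; have := tri_compat trS Spq Skl.
have := qmax' _ _ Skl; have := noleft' _ _ Skl; have := chord _ _ Skl; arclia.
Qed.

(** Reflection of the boundary line, exchanging the two ends of an arc. *)
Definition refl (x : int * int) : int * int := (- x.2, - x.1).

Definition refl_set (S : set (int * int)) : set (int * int) := [set x | S (refl x)].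

Lemma reflK : involutive refl.
Proof. by case=> i j; rewrite /refl /= !opprK. Qed.

Lemma refl_setK : involutive refl_set.
Proof. by move=> S; apply/seteqP; split=> x; rewrite /refl_set /= reflK. Qed.

Lemma refl_arcs x : arcs (refl x) <-> arcs x.
Proof. by split; arclia. Qed.

Lemma refl_crossing x y : crossing (refl x) (refl y) <-> crossing x y.
Proof. by split; arclia. Qed.

Lemma refl_compatible S : pairwise_compatible S -> pairwise_compatible (refl_set S).
Proof.
move=> [SA SC]; split=> [x /SA/refl_arcs//|x y Sx Sy /refl_crossing].
exact: SC.
Qed.

Lemma refl_triangulation S : triangulation S -> triangulation (refl_set S).
Proof.
move=> [SC maxS]; split; first exact: refl_compatible.
move=> R RC SR; rewrite -(maxS (refl_set R)) ?refl_setK //.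
  exact: refl_compatible.
by move=> x Sx; apply: SR; rewrite /refl_set /= reflK.
Qed.

Lemma refl_exchange S c c' :
  exchange (refl_set S) c c' -> exchange S (refl c) (refl c').
Proof.
move=> [Sc Ac cc' /refl_triangulation tr]; split=> //; first exact/refl_arcs.
  by move/(can_inj reflK).
congr triangulation: tr; apply/seteqP; split=> x; rewrite /refl_set /= reflK.
  move=> [[Sx xc]|<-]; last by right; rewrite reflK.
  by left; split=> // E; apply: xc; rewrite E reflK.
move=> [[Sx xc]|->]; last by right; rewrite reflK.
by left; split=> // E; apply: xc; rewrite -E reflK.
Qed.

Lemma refl_sole_exchange S c c' :
  sole_exchange (refl_set S) c c' -> sole_exchange S (refl c) (refl c').
Proof.
move=> [Ec sole]; split; first exact: refl_exchange.
move=> t; rewrite -{1}(refl_setK S) => /refl_exchange.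
by rewrite reflK => /sole <-; rewrite reflK.
Qed.

Lemma refl_crossed_by S d :
  crossed_by (refl_set S) (refl d) = refl @` crossed_by S d.
Proof.
apply/seteqP; split=> x.
  move=> [Sx xd]; exists (refl x); rewrite ?reflK//; split=> //.
  by apply/refl_crossing; rewrite reflK.
by move=> [y [Sy yd] <-]; split; [rewrite /refl_set /= reflK|apply/refl_crossing].
Qed.

Lemma flip_near_right S d :
  triangulation S -> arcs d -> finite_set (crossed_by S d) ->
  crossed_by S d !=set0 ->
  exists c c', [/\ crossed_by S d c, ~ crossing c' d, sole_exchange S c c' &
    forall y, crossed_by S d y -> away d.2 c y].
Proof.
move=> trS Ad fin [x xd].
have [||||c [c' [cd c'd Ecc' caway]]] := @flip_near_left (refl_set S) (refl d).
- exact: refl_triangulation.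
- exact/refl_arcs.
- by rewrite refl_crossed_by; apply: finite_image.
- by exists (refl x); rewrite refl_crossed_by; exists x.
exists (refl c), (refl c'); split.
- by move: cd; rewrite refl_crossed_by => -[y yd <-]; rewrite reflK.
- by move=> h; apply: c'd; apply/refl_crossing; rewrite reflK.
- exact: refl_sole_exchange.
move=> y yd; have := caway (refl y); rewrite refl_crossed_by.
move=> /(_ (imageP _ yd)); rewrite /away /=.
by do 2![case: ifPn => ?]; move=> [? ?]; split; lia.
Qed.

(** The first and the last arc crossed by [d] can only both be [x] if all arcs
    crossed by [d] lie on both sides of [x], that is, if [x] is the only one. *)
Lemma flip_uncross S d x :
  triangulation S -> arcs d -> finite_set (crossed_by S d) ->
  (exists2 y, crossed_by S d y & y <> x) -> crossed_by S d x ->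
  exists c c',
    [/\ crossed_by S d c, c <> x, ~ crossing c' d & sole_exchange S c c'].
Proof.
move=> trS Ad fin [y yd yx] xd.
have [|c [c' [cd c'd Ecc' caway]]] := flip_near_left trS Ad fin; first by exists x.
have [Ecx|/eqP cx] := eqVneq c x; last by exists c, c'.
have [|e [e' [ed e'd Eee' eaway]]] := flip_near_right trS Ad fin; first by exists x.
have [Eex|/eqP ex] := eqVneq e x; last by exists e, e'.
case: yx; have := eaway _ yd; have := caway _ yd; rewrite Ecx Eex.
case: yd xd => [Sy yd] [Sx xd]; have := tri_arcs trS Sy; have := tri_arcs trS Sx.
move: yd xd; rewrite /away /crossing; case: x {Sx Ecx Eex} => x1 x2.
case: y {Sy} => y1 y2 /= ? ? ? ?.
by case: ifPn => ?; case: ifPn => ? *; congr (_, _); lia.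
Qed.

Lemma flipP S c : mutable S c -> exchange S c (flip S c).
Proof. exact: xgetPex. Qed.

Lemma sole_exchange_flip S c c' : sole_exchange S c c' -> mutable S c /\ flip S c = c'.
Proof.
move=> [Ec sole]; have mc : mutable S c by exists c'.
by split=> //; apply: sole; apply: flipP.
Qed.

Lemma mutate_triangulation S c : mutable S c -> triangulation (mutate S c).
Proof. by move=> /flipP[]. Qed.

Lemma mutate_keep S c y : S y -> y <> c -> mutate S c y.
Proof. by move=> Sy yc; left. Qed.

Lemma mutate_flip S c : mutate S c (flip S c).
Proof. by right. Qed.

(** The first arc crossed by [d] is [x], and nothing crosses [d] after its flip, so
    [d] is the new arc by maximality. *)
Lemma flip_only_crossed S d x :
  triangulation S -> arcs d -> crossed_by S d x ->
  (forall y, crossed_by S d y -> y = x) -> mutable S x /\ flip S x = d.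
Proof.
move=> trS Ad xd only.
have fin : finite_set (crossed_by S d) by apply: sub_finite_set (finite_set1 x).
have [|c [c' [cd c'd Ecc' _]]] := flip_near_left trS Ad fin; first by exists x.
move: Ecc'; rewrite (only _ cd) => /sole_exchange_flip[mx fx]; split=> //.
have trS' := mutate_triangulation mx.
have [[Sd _]|->//] : mutate S x d.
  apply: (tri_max trS') => // y [[Sy yx] /crossingC yd|->].
    by apply: yx; apply: only.
  by rewrite fx => /crossingC.
by case: xd => Sx /(tri_compat trS Sx).
Qed.

(** * Finite sequences of flips *)

Definition mutate_list := foldl mutate.

Fixpoint arc_after S (s : seq (int * int)) x :=
  if s is t :: s' then arc_after (mutate S t) s' (mutate_arc S t x) else x.

Fixpoint flippable (P : set (int * int)) S (s : seq (int * int)) : Prop :=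
  if s is t :: s' then [/\ mutable S t, P t & flippable P (mutate S t) s'] else True.

Lemma flippable_sub (P Q : set (int * int)) S s :
  P `<=` Q -> flippable P S s -> flippable Q S s.
Proof.
move=> PQ; elim: s S => //= t s IHs S [mt /PQ Qt fs]; split=> //; exact: IHs.
Qed.

Lemma flippable_cat P S s t :
  flippable P S (s ++ t) <-> flippable P S s /\ flippable P (mutate_list S s) t.
Proof.
elim: s S => [|u s IHs] S /=; first by split=> [|[]].
by split=> [[mu Pu /IHs[]]|[[mu Pu fs] ft]]; split=> //; apply/IHs.
Qed.

Lemma arc_after_cat S s t x :
  arc_after S (s ++ t) x = arc_after (mutate_list S s) t (arc_after S s x).
Proof. by elim: s S x => //= u s IHs S x; rewrite IHs. Qed.

Lemma mutate_list_triangulation P S s :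
  triangulation S -> flippable P S s -> triangulation (mutate_list S s).
Proof.
elim: s S => //= t s IHs S trS [mt _]; apply: IHs; exact: mutate_triangulation.
Qed.

Lemma arc_after_in S s x : S x -> mutate_list S s (arc_after S s x).
Proof.
elim: s S x => //= t s IHs S x Sx; apply: IHs; rewrite /mutate_arc.
by case: eqP => xt; [exact: mutate_flip|exact: mutate_keep].
Qed.

Lemma arc_after_onto P S s y : flippable P S s -> mutate_list S s y ->
  exists2 x, S x & arc_after S s x = y.
Proof.
elim: s S => [|t s IHs] S /=; first by exists y.
move=> [[t' [St _ _ _]] _ fs] /(IHs _ fs)[z [[Sz zt]|->] <-].
  by exists z => //; rewrite /mutate_arc; case: eqP.
by exists t => //; rewrite /mutate_arc eqxx.
Qed.

Lemma arc_after_fix P S s x : flippable P S s -> ~ P x -> arc_after S s x = x.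
Proof.
elim: s S => //= t s IHs S [_ Pt fs] nPx; rewrite /mutate_arc.
by case: eqP => [xt|_]; [case: nPx; rewrite xt|exact: IHs].
Qed.

Lemma mutate_list_keep P S s x :
  flippable P S s -> ~ P x -> S x -> mutate_list S s x.
Proof.
by move=> fs nPx Sx; rewrite -(arc_after_fix fs nPx); apply: arc_after_in.
Qed.

Lemma crossed_by_mutate_list S s d :
  finite_set (crossed_by S d) -> finite_set (crossed_by (mutate_list S s) d).
Proof.
elim: s S => //= t s IHs S fin; apply: IHs.
apply: (@sub_finite_set _ _ (crossed_by S d `|` [set flip S t])).
  by move=> y [[[Sy _]|->] yd]; [left|right].
by rewrite finite_setU; split.
Qed.

(** Induction on the number of arcs crossed by [d]: as long as there is another one
    than [x], one at an end of [d] can be flipped away. So [x] is flipped last and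
    becomes [d]. *)
Lemma steer S d x :
  triangulation S -> arcs d -> finite_set (crossed_by S d) -> crossed_by S d x ->
  exists2 s, flippable (crossing ^~ d) S s & arc_after S s x = d.
Proof.
move=> trS Ad /finite_seqP[l /seteqP[+ _]].
have [n] := ubnP (size l); elim: n => // n IHn in l S trS *.
move=> ln Sl xd.
have [only|] := pselect (forall y, crossed_by S d y -> y = x).
  have [mx fx] := flip_only_crossed trS Ad xd only.
  by exists [:: x]; [split=> //; case: xd|rewrite /= /mutate_arc eqxx].
move=> /existsNP[y /not_implyP[yd yx]].
have fin : finite_set (crossed_by S d).
  by apply: (sub_finite_set Sl); apply/finite_seqP; exists l.
have [|c [c' [cd cx c'd /sole_exchange_flip[mc fc]]]] :=
  flip_uncross trS Ad fin _ xd; first by exists y.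
have [||||s fs sx] := IHn [seq z <- l | z != c] (mutate S c).
- exact: mutate_triangulation.
- have : (0 < count (pred1 c) l)%N by rewrite -has_count has_pred1; exact: Sl.
  have -> : size [seq z <- l | z != c] = (size l - count (pred1 c) l)%N.
    by rewrite size_filter -(count_predC (pred1 c) l) addKn.
  by have := count_size (pred1 c) l; move: ln; lia.
- move=> z [[[Sz zc]|->] zd]; last by case: c'd; rewrite -fc.
  by rewrite /= mem_filter /= (Sl z) // andbT; apply/eqP.
- by case: xd => Sx xd; split=> //; apply: mutate_keep => // /esym.
exists (c :: s); first by split=> //; case: cd.
by rewrite /= /mutate_arc; case: eqP => // /esym.
Qed.

(** * Infinite sequences of flips *)

Definition initial (theta : nat -> int * int) (k : nat) : seq (int * int) :=
  [seq theta i | i <- iota 1 k].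

Lemma initialS theta k : initial theta k.+1 = rcons (initial theta k) (theta k.+1).
Proof. by rewrite /initial -(addn1 k) iotaD map_cat -cats1 addnC. Qed.

Lemma initialD theta k m :
  exists s, initial theta (k + m) = initial theta k ++ s.
Proof. by rewrite /initial iotaD map_cat; eexists. Qed.

Lemma mutate_list_initial T theta k :
  mutate_list T (initial theta k) = mutate_iter T theta k.
Proof.
by elim: k => // k IHk; rewrite initialS /mutate_list foldl_rcons /= -IHk.
Qed.

Lemma arc_after_initial T theta k x :
  arc_after T (initial theta k) x = mutate_arc_iter T theta k x.
Proof.
elim: k => // k IHk.
by rewrite initialS -cats1 arc_after_cat /= mutate_list_initial IHk.
Qed.

Lemma index_set_gt0 I k : index_set I -> I k -> (0 < k)%N.
Proof. by move=> [[n _ ->] /andP[]|->]. Qed.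

Lemma index_set_down I k l : index_set I -> I k -> (0 < l <= k)%N -> I l.
Proof. by move=> [[n _ ->]|->] /=; lia. Qed.

Lemma index_set_max I k l : I k -> I l -> I (maxn k l).
Proof. by move=> Ik Il; rewrite /maxn; case: ifP. Qed.

Section Admissible.
Variables (I : set nat) (T : set (int * int)) (theta : nat -> int * int).
Hypotheses (indI : index_set I) (admT : admissible I T theta).

Lemma admissible_flippable k :
  k = 0%N \/ I k -> flippable setT T (initial theta k).
Proof.
case: admT => mutT _; elim: k => // k IHk [//|Ik].
rewrite initialS -cats1; apply/flippable_cat; split.
  apply: IHk; case: k Ik => [|k] Ik; [by left|right].
  by apply: index_set_down indI Ik _; lia.
by split=> //; rewrite mutate_list_initial; apply: (mutT k.+1).
Qed.

Lemma mutate_arc_seq_stable x k : stable_from I T theta x k ->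
  mutate_arc_seq I T theta x = mutate_arc_iter T theta k x.
Proof.
rewrite /mutate_arc_seq => st; have := @xgetI _ 0%N _ _ st.
set l := xget _ _; case: st => Ik stk [Il stl].
have Im := index_set_max Ik Il.
by rewrite -(stk _ Im) ?leq_maxl// -(stl _ Im) ?leq_maxr.
Qed.

End Admissible.

(** Only finitely many flips separate [T] from a stage at which a given arc of
    the limit is present, and that arc crosses nothing at that stage. *)
Lemma mutation_le_crossed T T' d :
  triangulation T -> mutation_le T T' -> T' d -> finite_set (crossed_by T d).
Proof.
move=> trT [I [theta [indI admT <-]]] [x Tx <-].
have [l st] : exists l, stable_from I T theta x l by case: admT => _; apply.
rewrite (mutate_arc_seq_stable st) -arc_after_initial.
have fl : flippable setT T (initial theta l).
  by apply: (admissible_flippable indI admT); right; case: st.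
have := arc_after_in (initial theta l) Tx.
move: (arc_after _ _ _) => {}d Sd {x Tx st}.
have : finite_set (crossed_by (mutate_list T (initial theta l)) d).
  suff -> : crossed_by (mutate_list T (initial theta l)) d = set0 by exact: finite_set0.
  apply/seteqP; split=> // y [Sy].
  exact: (tri_compat (mutate_list_triangulation trT fl)).
elim: (initial theta l) T fl {trT Sd admT} => //= t s IHs T [mt _ fs] fin.
apply: (@sub_finite_set _ _ (crossed_by (mutate T t) d `|` [set t])).
  move=> y [Ty yd]; have [->|/eqP yt] := eqVneq y t; first by right.
  by left; split=> //; apply: mutate_keep.
by rewrite finite_setU; split=> //; apply: IHs fin.
Qed.

Section Limit.
Variables (T T' : set (int * int)).
Hypotheses (trT : triangulation T) (trT' : triangulation T').

(** What a finite sequence of flips has to achieve for [x], both as an arc of [T]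
    (to have come to rest) and as an arc of [T'] (to have been produced). *)
Definition settled (s : seq (int * int)) (x : int * int) : Prop :=
  (T x -> T' (arc_after T s x)) /\ (T' x -> mutate_list T s x).

Lemma settled_cat s t x :
  flippable (~` T') T (s ++ t) -> settled s x -> settled (s ++ t) x.
Proof.
move=> /flippable_cat[_ ft] [h h']; split=> [Tx|T'x].
  by rewrite arc_after_cat (arc_after_fix ft); [apply: h|apply; apply: h].
rewrite /mutate_list foldl_cat; apply: (mutate_list_keep ft); last exact: h'.
exact.
Qed.

(** As no flip removes an arc of [T'], an arc stops moving once it is in [T']. *)
Lemma mutation_le_of_settled I theta : index_set I ->
  (forall k, I k -> flippable (~` T') T (initial theta k)) ->
  (forall x, exists2 k, I k & settled (initial theta k) x) ->
  mutation_le T T'.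
Proof.
move=> indI fl goals.
have stable x k : I k -> T' (mutate_arc_iter T theta k x) ->
    stable_from I T theta x k.
  move=> Ik T'x; split=> // m Im km; rewrite -!arc_after_initial in T'x *.
  have := fl _ Im; rewrite -(subnKC km); have [s ->] := initialD theta k (m - k).
  move=> /flippable_cat[_ fs].
  by rewrite arc_after_cat (arc_after_fix fs) //; exact.
have admT : admissible I T theta.
  split=> [i Ii|x Tx].
    have := index_set_gt0 indI Ii; case: i Ii => // i /fl.
    rewrite initialS -cats1 => /flippable_cat[_ []].
    by rewrite mutate_list_initial.
  have [k Ik [+ _]] := goals x.
  by rewrite arc_after_initial => /(_ Tx); exists k; apply: stable.
exists I, theta; split=> //; apply/seteqP; split=> y.
  move=> [x Tx <-]; have [k Ik [+ _]] := goals x.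
  rewrite arc_after_initial => /(_ Tx) T'x.
  by rewrite (mutate_arc_seq_stable (stable _ _ Ik T'x)).
move=> T'y; have [k Ik [_ /(_ T'y) ky]] := goals y.
have [x Tx xy] := arc_after_onto (fl _ Ik) ky; rewrite arc_after_initial in xy.
by exists x => //; rewrite (mutate_arc_seq_stable (stable _ _ Ik _)) xy.
Qed.

Hypothesis crossT : forall d, T' d -> finite_set (crossed_by T d).

Lemma settle_step s x d : flippable (~` T') T s -> T' d ->
  crossed_by (mutate_list T s) d x ->
  exists t, flippable (~` T') T (s ++ t) /\ arc_after (mutate_list T s) t x = d.
Proof.
move=> fs T'd xd.
have [|t ft tx] := steer (mutate_list_triangulation trT fs) (tri_arcs trT' T'd) _ xd.
  exact/crossed_by_mutate_list/crossT.
exists t; split=> //; apply/flippable_cat; split=> //.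
apply: flippable_sub ft => y yd T'y.
exact: (tri_compat trT' T'y T'd).
Qed.

(** An arc currently outside [T'] crosses an arc of [T'] by maximality of [T'], and
    can be steered onto it; an arc missing from the current triangulation [S]
    crosses an arc of [S], which can be steered onto it. *)
Lemma settle s x : flippable (~` T') T s ->
  exists t, flippable (~` T') T (s ++ t) /\ settled (s ++ t) x.
Proof.
move=> fs.
have [t [ft tx]] : exists t, flippable (~` T') T (s ++ t) /\
    (T x -> T' (arc_after T (s ++ t) x)).
  have [h|/not_implyP[Tx nT'x]] := pselect (T x -> T' (arc_after T s x)).
    by exists [::]; rewrite cats0.
  have Sx := arc_after_in s Tx.
  have [d [T'd xd]] : exists d, T' d /\ crossing (arc_after T s x) d.
    apply: contrapT => nod; apply: nT'x; apply: (tri_max trT') => [|d T'd xd].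
      exact: (tri_arcs (mutate_list_triangulation trT fs)).
    by apply: nod; exists d.
  have [t [ft tx]] := settle_step fs T'd (conj Sx xd).
  by exists t; split=> // _; rewrite arc_after_cat tx.
have [h|/not_implyP[T'x nSx]] := pselect (T' x -> mutate_list T (s ++ t) x).
  by exists t; split.
have trS := mutate_list_triangulation trT ft.
have [y [Sy yx]] : exists y, crossed_by (mutate_list T (s ++ t)) x y.
  apply: contrapT => noy; apply: nSx; apply: (tri_max trS) => [|y Sy /crossingC xy].
    exact: (tri_arcs trT').
  by apply: noy; exists y.
have [u [fu uy]] := settle_step ft T'x (conj Sy yx).
exists (t ++ u); rewrite catA; split=> //; split=> [Tx|_].
  case/flippable_cat: fu => _ fu.
  by rewrite arc_after_cat (arc_after_fix fu); [apply: tx|apply; apply: tx].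
by rewrite -uy /mutate_list foldl_cat; apply: arc_after_in.
Qed.

(** Settling all arcs in turn yields a growing chain of finite sequences of flips,
    whose union is a finite or infinite sequence. It is nonempty as [T <> T']. *)
Lemma mutation_le_of_crossed : T <> T' -> mutation_le T T'.
Proof.
move=> TT'.
have [ext extP] : exists ext : seq (int * int) -> int * int -> seq (int * int),
    forall s x, flippable (~` T') T s ->
    flippable (~` T') T (s ++ ext s x) /\ settled (s ++ ext s x) x.
  have H (sx : seq (int * int) * (int * int)) : exists t,
      flippable (~` T') T sx.1 ->
      flippable (~` T') T (sx.1 ++ t) /\ settled (sx.1 ++ t) sx.2.
    have [fs|nfs] := pselect (flippable (~` T') T sx.1); last by exists [::].
    by have [t ft] := settle sx.2 fs; exists t.
  by have [e eP] := choice H; exists (fun s x => e (s, x)) => s x; apply: (eP (s, x)).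
(* The [m]-th step settles the arc with code [m]; the default pair for numbers that
   code no arc only adds a redundant step. *)
pose chain := fix chain n := if n is m.+1
  then chain m ++ ext (chain m) (odflt (0, 0) (unpickle m)) else [::].
have chain_fl n : flippable (~` T') T (chain n).
  by elim: n => //= n fn; have [] := extP (chain n) (odflt (0, 0) (unpickle n)) fn.
have chainD n m : exists s, chain (n + m)%N = chain n ++ s.
  elim: m => [|m [s E]]; first by exists [::]; rewrite addn0 cats0.
  by rewrite addnS /= E -catA; eexists.
have chain_settled n x : (pickle x < n)%N -> settled (chain n) x.
  move=> xn; rewrite -(subnKC xn).
  have [s E] := chainD (pickle x).+1 (n - (pickle x).+1)%N; rewrite E.
  apply: settled_cat; first by rewrite -E.
  by have [_] := extP _ x (chain_fl (pickle x)); rewrite /= pickleK.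
pose stage i := xget 0%N [set n | (i <= size (chain n))%N].
pose theta i := nth (0, 0) (chain (stage i)) i.-1.
have chain_nth n m i : (i < size (chain n))%N -> (i < size (chain m))%N ->
    nth (0, 0) (chain n) i = nth (0, 0) (chain m) i.
  wlog nm : n m / (n <= m)%N => [hw|].
    by case/orP: (leq_total n m) => nm ? ?; [|symmetry]; apply: hw.
  move=> ni mi; rewrite -(subnKC nm); have [s ->] := chainD n (m - n)%N.
  by rewrite nth_cat ni.
have chain_initial n k : (k <= size (chain n))%N -> initial theta k = take k (chain n).
  move=> kn; apply: (@eq_from_nth _ (0, 0)) => [|i].
    by rewrite size_map size_iota size_takel.
  rewrite size_map size_iota => ik.
  rewrite (nth_map 0%N) ?size_iota // nth_iota // nth_take // add1n.
  apply: chain_nth => /=; last exact: leq_trans ik kn.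
  by apply: (@xgetI _ 0%N [set m | (i < size (chain m))%N] n); apply: leq_trans ik kn.
have [n1 n1P] : exists n, (0 < size (chain n))%N.
  apply: contrapT => no; apply: TT'.
  have nil n : chain n = [::].
    by apply/nilP; rewrite /nilp eqn0Ngt; apply/negP => ?; apply: no; exists n.
  apply/seteqP; split=> x; have [] := @chain_settled (pickle x).+1 x (ltnSn _);
    by rewrite nil.
(* The index set is finite if the chain stabilises, and infinite otherwise. *)
apply: (@mutation_le_of_settled
  [set k | (0 < k)%N /\ exists n, (k <= size (chain n))%N] theta).
- have [unb|] := pselect (forall k, exists n, (k <= size (chain n))%N).
    by right; apply/seteqP; split=> k; [case|split].
  move=> /existsNP[M /forallNP bnd].
  pose lens k := `[< exists n, size (chain n) = k >].
  have exl : exists k, lens k by exists 0%N; apply/asboolP; exists 0%N.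
  have lensM k : lens k -> (k <= M)%N.
    by move=> /asboolP[n <-]; have /negP := bnd n; rewrite -ltnNge => /ltnW.
  have maxP := ex_maxnP exl lensM.
  case: maxP => N /asboolP[n nN] maxN.
  have leN m : (size (chain m) <= N)%N by apply/maxN/asboolP; exists m.
  left; exists N; first exact: leq_trans n1P (leN _).
  apply/seteqP; split=> k /=.
    by move=> [k0 [m km]]; rewrite k0; apply: leq_trans km (leN _).
  by move=> /andP[k0 kN]; split=> //; exists n; rewrite nN.
- move=> k [_ [n kn]]; rewrite (chain_initial n) //.
  by have := chain_fl n; rewrite -{1}(cat_take_drop k (chain n)) => /flippable_cat[].
move=> x; set n := maxn n1 (pickle x).+1.
have [s E] := chainD n1 (n - n1)%N.
exists (size (chain n)).
  split; last by exists n.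
  by move: E; rewrite subnKC ?leq_maxl // => ->; rewrite size_cat; lia.
rewrite (chain_initial n) // take_size; apply: chain_settled.
by rewrite /n leq_max ltnSn orbT.
Qed.

End Limit.

(** * Reflexivity of mutation *)

(** If all arcs had length two, each longer arc would cross one of them. Then some
    [(i, i + 2)] is present, and [(i, i + 3)] can only cross [(i + 2, i + 4)], so
    that nothing is left for [(i, i + 4)] to cross. *)
Lemma triangulation_long_arc T : triangulation T ->
  exists i j, T (i, j) /\ i + 3 <= j.
Proof.
move=> trT; apply: contrapT => nolong.
have short k l : T (k, l) -> l = k + 2.
  move=> Tkl; have /= := tri_arcs trT Tkl; have [kl|] := lerP (k + 3) l; last by lia.
  by case: nolong; exists k, l.
have forced i j : i + 3 <= j -> exists k, T (k, k + 2) /\ crossing (i, j) (k, k + 2).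
  move=> ij; apply: contrapT => noc; apply: nolong; exists i, j; split=> //.
  apply: (tri_max trT) => [|[k l] Tkl]; first by arclia.
  by move: (Tkl); rewrite (short _ _ Tkl) => Tk kX; apply: noc; exists k.
have [i [Ti _]] := forced 0 3 isT.
have [k [Tk ik]] : exists k, T (k, k + 2) /\ crossing (i, i + 3) (k, k + 2).
  by apply: forced.
have ki : k = i + 2 by have := tri_compat trT Ti Tk; arclia.
have [m [Tm im]] : exists k, T (k, k + 2) /\ crossing (i, i + 4) (k, k + 2).
  by apply: forced; lia.
have := tri_compat trT Ti Tm; have := tri_compat trT Tk Tm; arclia.
Qed.

(** An arc of length at least three has a triangle below it, one of whose two lower
    sides is an arc with a triangle below it in turn. *)
Lemma triangulation_mutable T : triangulation T -> exists c, mutable T c.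
Proof.
move=> trT; have [i [j [Tij ij]]] := triangulation_long_arc trT.
have [m [imj eim emj]] := inner_triangle trT Tij.
have [Tim|mi] := eim.
  have [n [inm ein enm]] := inner_triangle trT Tim.
  exists (i, m), (n, j); apply: (@quad_exchange _ trT i n m j _ _ _ _ _ _ _ _ Tim _).1;
    by [lia|left|].
have [Tmj|mj] := emj; last by lia.
have [n [mnj emn enj]] := inner_triangle trT Tmj.
exists (m, j), (i, n); apply: (@quad_exchange _ trT i m n j _ _ _ _ _ _ _ _ Tmj _).1;
  by [lia|left|right|].
Qed.

(** Admissible sequences are nonempty, so even [T] itself has to be reached by
    flips: one arc is flipped and flipped back. *)
Lemma mutation_le_refl T : triangulation T -> mutation_le T T.
Proof.
move=> trT; have [c mc] := triangulation_mutable trT.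
have Ec := flipP mc; have Xc := exchange_crossing trT Ec.
have Tc : T c by case: Ec.
have trM := mutate_triangulation mc.
have [||mc' fc'] := @flip_only_crossed (mutate T c) c (flip T c) trM (tri_arcs trT Tc).
- by split=> //; apply: mutate_flip.
- move=> y [[[Ty yc]|->] //]; by move/(tri_compat trT Ty Tc).
pose theta (i : nat) := if i == 1%N then c else flip T c.
have back x : T x -> mutate_arc_iter T theta 2 x = x.
  move=> Tx; rewrite /= /theta /= /mutate_arc; case: (eqVneq x c) => [->|xc].
    by rewrite eqxx.
  case: eqP => // xE; case: (tri_compat trT Tx Tc).
  by rewrite xE.
pose I := [set i | (1 <= i <= 2)%N].
have indI : index_set I by left; exists 2%N.
have st x : T x -> stable_from I T theta x 2.
  by move=> Tx; split=> // k /andP[_ k2] k2'; have -> : k = 2%N by lia.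
exists I, theta; split=> //.
  split=> [i Ii|x Tx]; last by exists 2%N; apply: st.
  by case: i Ii => [|[|[|i]]].
apply/seteqP; split=> x.
  by move=> [y Ty <-]; rewrite (mutate_arc_seq_stable (st _ Ty)) back.
by move=> Tx; exists x => //; rewrite (mutate_arc_seq_stable (st _ Tx)) back.
Qed.

Lemma mutation_leP T T' : triangulation T -> triangulation T' ->
  mutation_le T T' <-> forall d, T' d -> finite_set (crossed_by T d).
Proof.
move=> trT trT'; split=> [leTT' d|fin]; first exact: mutation_le_crossed.
have [->|/eqP TT'] := eqVneq T T'; first exact: mutation_le_refl.
exact: mutation_le_of_crossed.
Qed.

(** * Fountains *)

Lemma left_fountainP T n :
  left_fountain T n <-> forall m, exists2 p, p < m & T (p, n).
Proof.
split=> [inf m|unb fin].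
  apply: contrapT => nop; apply: inf.
  apply: sub_finite_set (finite_set_itv m (n - 2)) => p /= [pn Tp].
  rewrite pn andbT; case: lerP => // pm.
  by case: nop; exists p.
have [M pM] := finite_set_ubound (fun p => - p) fin.
have [p pm Tp] := unb (Num.min (- M) (n - 2)).
by have := pM p (conj _ Tp); lia.
Qed.

Lemma right_fountainP T n :
  right_fountain T n <-> forall m, exists2 p, m < p & T (n, p).
Proof.
split=> [inf m|unb fin].
  apply: contrapT => nop; apply: inf.
  apply: sub_finite_set (finite_set_itv (n + 2) m) => p /= [pn Tp].
  rewrite pn /=; case: lerP => // pm.
  by case: nop; exists p.
have [M pM] := finite_set_ubound id fin.
have [p pm Tp] := unb (Num.max M (n + 2)).
by have := pM p (conj _ Tp); lia.
Qed.

Lemma refl_left_fountain T n : left_fountain (refl_set T) n -> right_fountain T (- n).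
Proof.
move=> /left_fountainP unb; apply/right_fountainP => m.
by have [p pm Tp] := unb (- m); exists (- p) => //; lia.
Qed.

Lemma refl_right_fountain T n : right_fountain T n -> left_fountain (refl_set T) (- n).
Proof.
move=> /right_fountainP unb; apply/left_fountainP => m.
by have [p pm Tp] := unb (- m); exists (- p); [lia|rewrite /refl_set /refl /= !opprK].
Qed.

Definition spans (y : int * int) (n : int) : Prop := y.1 < n < y.2.

(** If [T] has no left fountain at [b], its arcs and edges ending at [b] have a
    leftmost left endpoint [a]. If there were no left fountain at [a] either, the
    leftmost neighbour [c] of [a] would give an arc [(c, b)] crossing nothing. *)
Lemma left_fountain_exists T b :
  triangulation T -> (forall y, T y -> ~ spans y b) ->
  exists2 a, a <= b & left_fountain T a.
Proof.
move=> trT nospan.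
have leftmost n : ~ left_fountain T n ->
    exists2 a, edge T a n & forall p, edge T p n -> a <= p.
  move=> /left_fountainP/existsNP[m nom].
  apply: (@int_min (fun p => edge T p n) (Num.min m (n - 1))).
    by exists (n - 1); right; lia.
  move=> p [Tp|->]; last by lia.
  by have [|pm] := lerP m p; [lia|case: nom; exists p].
have [|/leftmost[a Eab amin]] := pselect (left_fountain T b); first by exists b.
have ab := edge_lt trT Eab.
exists a; first exact: ltW.
apply: contrapT => /leftmost[c Eca cmin]; have ca := edge_lt trT Eca.
suff /amin : edge T c b by lia.
apply: (edge_max trT) => [|k l Tkl]; first by lia.
have cmin' : l = a -> c <= k by move=> E; apply: cmin; left; rewrite -E.
have amin' : l = b -> a <= k by move=> E; apply: amin; left; rewrite -E.
have := edge_compat trT Eab Tkl; have := edge_compat trT Eca Tkl.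
have := nospan _ Tkl; rewrite /spans; arclia.
Qed.

Lemma right_fountain_exists T a :
  triangulation T -> (forall y, T y -> ~ spans y a) ->
  exists2 b, a <= b & right_fountain T b.
Proof.
move=> /refl_triangulation trT nospan.
have [|b ba /refl_left_fountain Tb] := @left_fountain_exists _ (- a) trT.
  by move=> y /nospan; rewrite /spans /=; lia.
by exists (- b) => //; lia.
Qed.

Lemma left_fountain_crossed T a d :
  left_fountain T a -> spans d a -> ~ finite_set (crossed_by T d).
Proof.
move=> /left_fountainP unb da /(finite_set_ubound (fun x => - x.1))[M xM].
have [p pm Tp] := unb (Num.min (- M) d.1).
by have := xM (p, a) (conj Tp _); move: da; rewrite /spans; arclia.
Qed.

Lemma right_fountain_crossed T b d :
  right_fountain T b -> spans d b -> ~ finite_set (crossed_by T d).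
Proof.
move=> /right_fountainP unb db /(finite_set_ubound snd)[M xM].
have [p pm Tp] := unb (Num.max M d.2).
by have := xM (b, p) (conj Tp _); move: db; rewrite /spans; arclia.
Qed.

Lemma finite_crossed_self T d : triangulation T -> T d -> finite_set (crossed_by T d).
Proof.
move=> trT Td; rewrite (_ : crossed_by T d = set0) //.
by apply/seteqP; split=> // y [Ty]; apply: (tri_compat trT).
Qed.

Lemma left_fountain_uniq T a a' :
  triangulation T -> left_fountain T a -> left_fountain T a' -> a = a'.
Proof.
move=> trT; wlog aa' : a a' / a < a' => [hw|].
  by case: (ltgtP a a') => // aa' *; [|symmetry]; apply: hw.
move=> /left_fountainP Ta /left_fountainP Ta'.
have [p pa Tp] := Ta' a; have [q qp Tq] := Ta p.
by have := tri_compat trT Tp Tq; arclia.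
Qed.

Lemma right_fountain_uniq T b b' :
  triangulation T -> right_fountain T b -> right_fountain T b' -> b = b'.
Proof.
move=> /refl_triangulation trT /refl_right_fountain Tb /refl_right_fountain Tb'.
by apply/oppr_inj/(left_fountain_uniq trT).
Qed.

Definition arcs_at (T : set (int * int)) (l : int) : set (int * int) :=
  [set x | T x /\ (x.1 = l \/ x.2 = l)].

Lemma arcs_at_finite T l : triangulation T ->
  ~ left_fountain T l -> ~ right_fountain T l -> finite_set (arcs_at T l).
Proof.
move=> trT /contrapT finl /contrapT finr.
apply: (@sub_finite_set _ _
  ((fun p => (p, l)) @` [set p | p <= l - 2 /\ T (p, l)] `|`
   (fun p => (l, p)) @` [set p | l + 2 <= p /\ T (l, p)])); last first.
  by rewrite finite_setU; split; apply: finite_image.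
case=> k m [Tkm /= kml]; have /= km := tri_arcs trT Tkm.
case: kml => E; rewrite E in Tkm km *; [right; exists m|left; exists k] => //.
by split=> //; lia.
Qed.

Lemma locally_finite_no_left T a : locally_finite T -> ~ left_fountain T a.
Proof.
move=> lfT; apply; apply: sub_finite_set (finite_image fst (lfT a)).
by move=> p [_ Tp]; exists (p, a) => //; split=> //; right.
Qed.

Lemma locally_finite_or_fountains T : triangulation T ->
  locally_finite T \/ exists a b, [/\ a <= b, left_fountain T a & right_fountain T b].
Proof.
move=> trT; have [|/existsNP[l infl]] := pselect (locally_finite T); [by left|right].
have [Tl|nTl] := pselect (left_fountain T l).
  have [|b lb Tb] := @right_fountain_exists T l trT; last by exists l, b.
  by move=> y Ty /(left_fountain_crossed Tl); apply; apply: finite_crossed_self.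
have [Tl|nTr] := pselect (right_fountain T l).
  have [|a al Ta] := @left_fountain_exists T l trT; last by exists a, l.
  by move=> y Ty /(right_fountain_crossed Tl); apply; apply: finite_crossed_self.
by case: infl; apply: arcs_at_finite.
Qed.

(** No arc of [T'] spans [a], since it would cross infinitely many arcs of the
    fountain of [T] at [a]. *)
Lemma mutation_le_left_fountain T T' a :
  triangulation T -> triangulation T' -> mutation_le T T' -> left_fountain T a ->
  exists2 a', a' <= a & left_fountain T' a'.
Proof.
move=> trT trT' /(mutation_leP trT trT') fin Ta; apply: left_fountain_exists => //.
by move=> y /fin + /(left_fountain_crossed Ta).
Qed.

Lemma mutation_le_right_fountain T T' b :
  triangulation T -> triangulation T' -> mutation_le T T' -> right_fountain T b ->
  exists2 b', b <= b' & right_fountain T' b'.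
Proof.
move=> trT trT' /(mutation_leP trT trT') fin Tb; apply: right_fountain_exists => //.
by move=> y /fin + /(right_fountain_crossed Tb).
Qed.

(** Every arc crossed by [d] has an endpoint strictly between those of [d]. *)
Lemma crossed_by_finite T d :
  (forall l, spans d l -> finite_set (arcs_at T l)) -> finite_set (crossed_by T d).
Proof.
move=> fin.
apply: (@sub_finite_set _ _
  (\bigcup_(l in [set l | d.1 + 1 <= l <= d.2 - 1]) arcs_at T l)).
  move=> y [Ty yd]; have [h|h] := pselect (spans d y.1).
    by exists y.1; [move: h; rewrite /spans /=; lia|split=> //; left].
  by exists y.2; [move: h; rewrite /spans /=; arclia|split=> //; right].
apply: bigcup_finite => [|l /= dl]; first exact: finite_set_itv.
by apply: fin; rewrite /spans; lia.
Qed.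

Lemma mutation_le_locally_finite T T' :
  triangulation T -> triangulation T' -> locally_finite T -> mutation_le T T'.
Proof.
move=> trT trT' lfT; apply/mutation_leP => // d _.
by apply: crossed_by_finite => l _; apply: lfT.
Qed.

(** An arc [d] of [T'] spans neither [a] nor [b], the only marked points at which
    [T] has infinitely many arcs. *)
Lemma mutation_le_fountains T T' a b :
  triangulation T -> triangulation T' ->
  left_fountain T a -> right_fountain T b ->
  left_fountain T' a -> right_fountain T' b -> mutation_le T T'.
Proof.
move=> trT trT' Ta Tb T'a T'b; apply/mutation_leP => // d T'd.
have fd := finite_crossed_self trT' T'd.
apply: crossed_by_finite => l dl; apply: arcs_at_finite => //.
  move=> /(left_fountain_uniq trT Ta) E.
  by apply: (left_fountain_crossed T'a _ fd); rewrite E.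
move=> /(right_fountain_uniq trT Tb) E.
by apply: (right_fountain_crossed T'b _ fd); rewrite E.
Qed.

(** Under [mutation_le] the left fountain moves only to the left and the right one
    only to the right, so both stay in place if there is also a way back. *)
Lemma strongly_mutation_equivalentP T T' : triangulation T -> triangulation T' ->
  strongly_mutation_equivalent T T' <->
  ((locally_finite T /\ locally_finite T') \/
   exists a b : int,
     [/\ a <= b, left_fountain T a, right_fountain T b,
         left_fountain T' a & right_fountain T' b]).
Proof.
move=> trT trT'; split; last first.
  move=> [[lfT lfT']|[a [b [_ Ta Tb T'a T'b]]]].
    by split; apply: mutation_le_locally_finite.
  by split; apply: mutation_le_fountains; eassumption.
move=> [leTT' leT'T].
have [lfT|[a [b [ab Ta Tb]]]] := locally_finite_or_fountains trT.
  have [lfT'|[a [b [_ T'a _]]]] := locally_finite_or_fountains trT'; first by left.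
  have [a' _ Ta'] := mutation_le_left_fountain trT' trT leT'T T'a.
  by case: (locally_finite_no_left lfT Ta').
have [a1 a1a T'a1] := mutation_le_left_fountain trT trT' leTT' Ta.
have [b1 bb1 T'b1] := mutation_le_right_fountain trT trT' leTT' Tb.
have [a2 a2a1 Ta2] := mutation_le_left_fountain trT' trT leT'T T'a1.
have [b2 b1b2 Tb2] := mutation_le_right_fountain trT' trT leT'T T'b1.
have a2E := left_fountain_uniq trT Ta2 Ta.
have b2E := right_fountain_uniq trT Tb2 Tb.
have a1E : a1 = a by lia.
have b1E : b1 = b by lia.
by right; exists a, b; rewrite a1E b1E in T'a1 T'b1.
Qed.

(** * A triangulation in each class *)

Lemma triangulation_intro S : pairwise_compatible S ->
  (forall z, arcs z -> (forall y, S y -> ~ crossing z y) -> S z) -> triangulation S.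
Proof.
move=> SC max; split=> // R [RA RC] SR; apply/seteqP; split=> // z Rz.
by apply: max => [|y /SR]; [exact: RA|exact: RC].
Qed.

(** The arcs (-1, 1), (-1, 2), (-2, 2), (-2, 3), ... form an infinite zigzag path. *)
Definition zigzag : set (int * int) :=
  [set x | x.1 <= -1 /\ (x.2 = - x.1 \/ x.2 = - x.1 + 1)].

Lemma zigzag_triangulation : triangulation zigzag.
Proof.
apply: triangulation_intro => [|[k l] Akl noX]; rewrite /zigzag.
  by split=> [x|x y] /=; arclia.
have X k' l' : zigzag (k', l') -> ~ crossing (k, l) (k', l') by apply: noX.
have := X (k - 1) (- k + 1); have := X (k + 1) (- k); have := X (- k - 1) (k + 1).
by rewrite /zigzag; arclia.
Qed.

Lemma zigzag_locally_finite : locally_finite zigzag.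
Proof.
move=> l; apply: (@sub_finite_set _ _
  [set (l, - l); (l, - l + 1); (- l, l); (- l + 1, l)]); last exact: finite_set4.
case=> i j; rewrite /zigzag /= => -[[_ ij] ijl].
have : (i = l /\ j = - l) \/ (i = l /\ j = - l + 1) \/ (i = - l /\ j = l) \/
  (i = - l + 1 /\ j = l) by lia.
by case=> [[-> ->]|[[-> ->]|[[-> ->]|[-> ->]]]]; do ?[by right|left].
Qed.

(** Two infinite fans; the polygon between them is triangulated by a fan at [a]. *)
Definition fans (a b : int) : set (int * int) :=
  [set x | x.1 <= x.2 - 2 /\ (x.2 = a \/ x.1 = b \/ (x.1 = a /\ x.2 <= b))].

(** A missing arc [(k, l)] crosses an arc of one of the fans: a far one if it spans
    [a] or [b], and otherwise the one at [k + 1] in the fan of its region. *)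
Lemma fans_triangulation a b : a <= b -> triangulation (fans a b).
Proof.
move=> ab; apply: triangulation_intro => [|[k l] Akl noX]; rewrite /fans.
  by split=> [x|x y] /=; arclia.
have X k' l' : fans a b (k', l') -> ~ crossing (k, l) (k', l') by apply: noX.
have := X (Num.min k a - 2) a; have := X b (Num.max l b + 2).
have := X (k + 1) a; have := X a (k + 1); have := X b (k + 1).
by rewrite /fans; arclia.
Qed.

Lemma fans_left_fountain a b : left_fountain (fans a b) a.
Proof.
apply/left_fountainP => m; exists (Num.min (m - 1) (a - 2)); first by lia.
by rewrite /fans /=; lia.
Qed.

Lemma fans_right_fountain a b : right_fountain (fans a b) b.
Proof.
apply/right_fountainP => m; exists (Num.max (m + 1) (b + 2)); first by lia.
by rewrite /fans /=; lia.
Qed.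

Theorem theorem4p8 :
  (* every triangulation lies in exactly one of the sets *)
  (forall T : set (int * int), triangulation T ->
     (T_lf T /\ (forall a b : int, a <= b -> ~ T_fountains a b T)) \/
     (~ T_lf T /\ exists! p : int * int, p.1 <= p.2 /\ T_fountains p.1 p.2 T)) /\
  (* each of the sets is a strong mutation equivalence class *)
  strong_mutation_class T_lf /\
  (forall a b : int, a <= b -> strong_mutation_class (T_fountains a b)) /\
  (* the equivalence relation on triangulations, explicitly *)
  (forall T T' : set (int * int), triangulation T -> triangulation T' ->
     (strongly_mutation_equivalent T T' <->
      ((locally_finite T /\ locally_finite T') \/
       exists a b : int,
         [/\ a <= b, left_fountain T a, right_fountain T b,
             left_fountain T' a & right_fountain T' b]))).
Proof.
split; [|split; [|split]].
- move=> T trT.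
  have [lfT|[a [b [ab Ta Tb]]]] := locally_finite_or_fountains trT.
    by left; split=> // a b _ [_ /(locally_finite_no_left lfT)].
  right; split; first by move=> [_ /locally_finite_no_left] /(_ _ Ta).
  exists (a, b); split=> // -[a' b'] [/= _ [_ Ta' Tb']].
  by rewrite (left_fountain_uniq trT Ta Ta') (right_fountain_uniq trT Tb Tb').
- exists zigzag; first exact: zigzag_triangulation.
  have lfZ := zigzag_locally_finite.
  apply/seteqP; split=> T /= [trT].
    move=> lfT; split=> //; apply/strongly_mutation_equivalentP => //.
      exact: zigzag_triangulation.
    by left.
  move/(strongly_mutation_equivalentP zigzag_triangulation trT).
  by move=> [[]|[a [b [_ /(locally_finite_no_left lfZ)]]]].
- move=> a b ab; have trF := fans_triangulation ab.
  have [Fa Fb] := (@fans_left_fountain a b, @fans_right_fountain a b).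
  exists (fans a b) => //; apply/seteqP; split=> T.
    move=> [trT Ta Tb]; split=> //; apply/strongly_mutation_equivalentP => //.
    by right; exists a, b.
  move=> [trT /(strongly_mutation_equivalentP trF trT)].
  case=> [[/locally_finite_no_left/(_ Fa)]//|[a' [b' [_ Fa' Fb' Ta Tb]]]].
  by rewrite (left_fountain_uniq trF Fa Fa') (right_fountain_uniq trF Fb Fb').
- exact: strongly_mutation_equivalentP.
Qed.
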